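(* Let $N\ge1$, let $x_1,\dots,x_N$ be nonzero real numbers, let $i\in\{1,\dots,N\}$ and put $p=x_i$. Let $d_k(p)$ be the coefficients of the polynomial $P(t)=t(1-t)\prod_{j=1}^N(1-x_jt)$ expanded in powers of $u=1-pt$, i.e. $P(t)=\sum_{k=0}^{N+2}d_k(p)u^k$. Then for $k=0,\dots,N+2$, $$d_k(p)=\frac{x_1\cdots x_N}{p^{N+2}}\left[\sigma_{N+1-k}\Bigl(p-1,\bigl(\tfrac{p-x_j}{x_j}\bigr)_{j\ne i}\Bigr)-\sigma_{N+2-k}\Bigl(p-1,\bigl(\tfrac{p-x_j}{x_j}\bigr)_{j\ne i}\Bigr)\right].$$ In particular $d_0(x_i)=0$.
   Context: $\sigma_l(y_1,\dots,y_k)$ is the $l$-th elementary symmetric polynomial in $k$ variables, with $\sigma_0=1$ (also for $k=0$) and $\sigma_l=0$ if $l<0$ or $l>k$. In families indexed by $j\neq i$, the index $j$ runs over $\{1,\dots,N\}\setminus\{i\}$. *)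

(* Defs.v *)
From HB Require Import structures.
From mathcomp Require Import all_boot all_order all_algebra.
From mathcomp Require Import reals.
From mathcomp Require Import mpoly.

Set Implicit Arguments.
Unset Strict Implicit.
Unset Printing Implicit Defensive.

Import Order.TTheory GRing.Theory Num.Theory.
Local Open Scope ring_scope.

(* The degree [l] is an integer, so that negative degrees give 0 instead of
   being truncated to degree 0.  For [m > size y], [mesym (size y) R m] is 0. *)
Definition sigma (R : comNzRingType) (l : int) (y : seq R) : R :=
  match l with
  | Posz m => (mesym (size y) R m).@[tnth (in_tuple y)]
  | Negz _ => 0
  end.

Definition Ppoly (R : comNzRingType) (N : nat) (x : 'I_N -> R) : {poly R} :=
  'X * (1 - 'X) * \prod_(j < N) (1 - x j *: 'X).

(* [d 0, ..., d (n-1)] are the coefficients of [P] in powers of [1 - p t];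
   the values [d k] for [k >= n] are irrelevant. *)
Definition expansion (R : comNzRingType) (P : {poly R}) (p : R) (n : nat)
    (d : nat -> R) : Prop :=
  P = \sum_(k < n) d k *: (1 - p *: 'X) ^+ k.

Lemma sigma0 (R : comNzRingType) (y : seq R) : sigma 0 y = 1.
Proof. by rewrite /sigma /= mesym0E meval1. Qed.

Lemma sigma_lt0 (R : comNzRingType) (l : int) (y : seq R) :
  l < 0 -> sigma l y = 0.
Proof. by case: l. Qed.

Lemma sigma_gt_size (R : comNzRingType) (l : int) (y : seq R) :
  (size y)%:Z < l -> sigma l y = 0.
Proof.
by case: l => // m hm; rewrite /sigma mesym_geqnE ?meval0.
Qed.

Lemma size_Ppoly (R : comNzRingType) (N : nat) (x : 'I_N -> R) :
  (size (Ppoly x) <= N.+3)%N.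
Proof.
have hs (a : R) : (size (1 - a *: 'X : {poly R})%R <= 2)%N.
  apply: (leq_trans (size_polyD _ _)); rewrite geq_max size_poly1 size_polyN /=.
  by rewrite (leq_trans (size_scale_leq _ _)) // size_polyX.
have hM (p q : {poly R}) m n : (size p <= m.+1)%N -> (size q <= n.+1)%N ->
    (size (p * q)%R <= (m + n).+1)%N.
  move=> hp hq; apply: (leq_trans (size_polyMleq _ _)).
  by rewrite -subn1 leq_subLR (leq_trans (leq_add hp hq)) // addSn addnS.
have hprod n (f : 'I_n -> R) :
    (size (\prod_(j < n) (1 - f j *: 'X : {poly R}))%R <= n.+1)%N.
  elim: n f => [|n IH] f; first by rewrite big_ord0 size_poly1.
  by rewrite big_ord_recl (@hM _ _ 1%N n).
have hX1 : (size ('X * (1 - 'X) : {poly R})%R <= 3)%N.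
  by rewrite (@hM _ _ 1%N 1%N) // ?size_polyX // -['X]scale1r hs.
exact: (@hM _ _ 2 N).
Qed.

(* With [size_Ppoly], this shows that the coefficients of [Ppoly x] in powers
   of [1 - p t] exist for [n = N + 3]; [expansion] is thus satisfiable. *)
Lemma expansion_exists (F : fieldType) (P : {poly F}) (p : F) (n : nat) :
  p != 0 -> (size P <= n)%N -> exists d, expansion P p n d.
Proof.
move=> p0 hn; pose q : {poly F} := p^-1 *: (1 - 'X).
exists (fun k => (P \Po q)`_k).
have sq : (size q <= 2)%N.
  rewrite (leq_trans (size_scale_leq _ _)) // (leq_trans (size_polyD _ _)) //.
  by rewrite size_polyN size_polyX size_poly1.
have sPq : (size (P \Po q) <= n)%N.
  rewrite comp_polyE (leq_trans (size_sum _ _ _)) //.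
  apply/bigmax_leqP => k _; rewrite (leq_trans (size_scale_leq _ _)) //.
  rewrite (leq_trans (size_poly_exp_leq _ _)) //.
  rewrite (leq_trans _ (leq_trans (ltn_ord k) hn)) // ltnS.
  by rewrite -[X in (_ <= X)%N]mul1n leq_mul2r -subn1 leq_subLR sq orbT.
rewrite /expansion.
transitivity ((P \Po q) \Po (1 - p *: 'X)); last first.
  rewrite comp_polyE (big_ord_widen n (fun k => (P \Po q)`_k *: _ ^+ k) sPq).
  rewrite big_mkcond; apply: eq_bigr => k _; case: ltnP => // hk.
  by rewrite nth_default ?scale0r.
rewrite -comp_polyA.
suff -> : q \Po (1 - p *: 'X) = 'X by rewrite comp_polyXr.
rewrite /q linearZ /= comp_polyB comp_polyX comp_polyC /=.
by rewrite opprB addrC subrK scalerA mulVf // scale1r.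
Qed.

(* Main.v *)
Require Import Defs.
From HB Require Import structures.
From mathcomp Require Import all_boot all_order all_algebra.
From mathcomp Require Import reals.
From mathcomp Require Import mpoly.
From mathcomp Require Import ring zify.

Set Implicit Arguments.
Unset Strict Implicit.
Unset Printing Implicit Defensive.

Import Order.TTheory GRing.Theory Num.Theory.
Local Open Scope ring_scope.

(** The substitution [t = (1 - u) / p] turns powers of [1 - p t] into powers of
    [u], so [d k] is the coefficient of [u ^ k] in [P((1 - u) / p)]. Every factor
    of [P] becomes [p^-1] times a linear factor in [u]:
    [t] gives [1 - u], [1 - t] gives [u + (p - 1)], and [1 - x_j t] gives
    [x_j * (u + (p - x_j) / x_j)], which for [x_j = p] is [p * u]. Hence
    [P = c * (u - u ^ 2) * Q(u)], where [c = x_1 ... x_N / p ^ (N + 2)] and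
    [Q(u)] is the product of [u + a] over the [N] arguments [a] of the symmetric
    functions. By Vieta's formula ([coef_prod_XaddC]) the coefficient of [u ^ m]
    in [Q] is [sigma (N - m)]; the terms [u] and [- u ^ 2] shift [m] to [k - 1]
    and [k - 2], giving the two terms of the formula. The factor [u] coming from
    [x_i = p] is also why [d 0] vanishes. *)

(** Vieta's formula. A monomial of the expanded product is a choice of a set [J]
    of factors contributing their constant; it has degree [size y - #|J|]. *)
Lemma coef_prod_XaddC (R : comNzRingType) (y : seq R) (m : nat) :
  (\prod_(a <- y) ('X + a%:P))`_m = sigma ((size y)%:Z - m%:Z) y.
Proof.
pose v := tnth (in_tuple y).
have -> : \prod_(a <- y) ('X + a%:P) =
    \sum_(J : {set 'I_(size y)})
       (\prod_(j in J) v j) *: 'X^(size y - #|J|) :> {poly R}.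
  (* [bigA_distr] takes the summand chosen on [J] as the left one. *)
  rewrite big_tnth; under eq_bigr => j _ do rewrite addrC.
  rewrite bigA_distr; apply: eq_bigr => J _.
  rewrite (bigID (mem J)) /= (eq_bigr (fun j => (v j)%:P)); last first.
    by move=> j ->.
  rewrite -rmorph_prod /= -mul_polyC; congr (_ * _).
  rewrite (eq_bigr (fun=> 'X)); last by move=> j /negbTE ->.
  rewrite prodr_const; congr (_ ^+ _).
  by rewrite -[X in (X - _)%N]card_ord -(cardC (mem J)) addKn.
rewrite coef_sum; under eq_bigr => J _ do rewrite coefZ coefXn.
case: (leqP m (size y)) => [le_my | lt_ym]; last first.
  rewrite sigma_lt0 ?big1 // => [J _|]; last by lia.
  by case: eqP => [|_]; [lia | rewrite mulr0].
have -> : (size y)%:Z - m%:Z = (size y - m)%N by lia.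
rewrite /sigma /mesym rmorph_sum /= [RHS]big_mkcond /=.
apply: eq_bigr => J _.
have leJ : (#|J| <= size y)%N by rewrite -[leqRHS]card_ord max_card.
have -> : (m == size y - #|J|)%N = (#|J| == size y - m)%N by lia.
case: eqP => _; last by rewrite mulr0.
by rewrite mulr1 rmorph_prod; apply: eq_bigr => j _; rewrite /= mevalXU.
Qed.

(** Composition with [(1 - X) / p] inverts [t |-> 1 - p t], which makes the
    coefficients of the expansion unique. *)
Lemma expansion_coef (F : fieldType) (P : {poly F}) (p : F) (n : nat)
    (d : nat -> F) (k : nat) :
  p != 0 -> expansion P p n d -> (k < n)%N ->
  d k = (P \Po (p^-1 *: (1 - 'X)))`_k.
Proof.
move=> p0 -> lt_kn; rewrite rmorph_sum /= coef_sum.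
have sub_inv : (1 - p *: 'X) \Po (p^-1 *: (1 - 'X)) = 'X :> {poly F}.
  rewrite comp_polyB comp_polyZ comp_polyX comp_polyC scalerA divff //.
  by rewrite scale1r subKr.
under eq_bigr => j _ do rewrite comp_polyZ rmorphXn /= sub_inv coefZ coefXn.
rewrite (bigD1 (Ordinal lt_kn)) //= eqxx mulr1 big1 ?addr0 // => j.
by rewrite -val_eqE eq_sym /= => /negbTE ->; rewrite mulr0.
Qed.

Lemma Ppoly_comp (F : fieldType) (N : nat) (x : 'I_N -> F) (i : 'I_N) :
  (forall j, x j != 0) ->
  Ppoly x \Po ((x i)^-1 *: (1 - 'X)) =
  (\prod_(j < N) x j / x i ^+ (N + 2)) *:
    (('X - 'X^2) * \prod_(a <- x i - 1 ::
       [seq (x i - x j) / x j | j <- enum 'I_N & j != i]) ('X + a%:P)).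
Proof.
move=> x0; set p := x i; have p0 : p != 0 by exact: x0.
have factor (a : F) : a != 0 ->
    (1 - a *: 'X) \Po (p^-1 *: (1 - 'X)) =
    (a / p)%:P * ('X + ((p - a) / a)%:P).
  move=> a0; rewrite comp_polyB comp_polyZ comp_polyX comp_polyC scalerA.
  rewrite mulrDr -polyCM.
  have -> : a / p * ((p - a) / a) = 1 - a / p by field; rewrite a0 p0.
  by rewrite -mul_polyC polyCB; ring.
have factor1 := factor 1 (oner_neq0 F); rewrite scale1r in factor1.
rewrite /Ppoly !rmorphM rmorph_prod /= comp_polyX factor1.
under eq_bigr => j _ do rewrite factor ?x0 //.
rewrite big_split /= -rmorph_prod big_split /= prodr_const card_ord.
rewrite big_cons big_map big_filter big_enum_cond /=.
(* The factor [j = i] is [u], as [(p - p) / p = 0]. *)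
rewrite [X in _ * (_ * X)](bigD1 i) //= subrr mul0r polyC0 addr0.
rewrite divr1 exprD invfM -exprVn -!mul_polyC !rmorphM /=.
by rewrite -exprVn !rmorphXn polyC1; ring.
Qed.

Theorem lemma4p8 (R : realType) (N : nat) (hN : (1 <= N)%N)
    (x : 'I_N -> R) (hx : forall j : 'I_N, x j != 0)
    (i : 'I_N) (p : R) (hp : p = x i)
    (d : nat -> R) (hd : expansion (Ppoly x) p N.+3 d) :
  let y : seq R :=
    p - 1 :: [seq (p - x j) / x j | j <- enum 'I_N & j != i] in
  (forall k : nat, (k <= N + 2)%N ->
     d k = (\prod_(j < N) x j) / p ^+ (N + 2)
           * (sigma (N%:Z + 1 - k%:Z) y - sigma (N%:Z + 2 - k%:Z) y))
  /\ d 0%N = 0.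
Proof.
move=> y.
have size_y : size y = N.
  rewrite /= size_map enumT -[filter _ _]/(enum (predC1 i)) -cardE cardC1.
  by rewrite card_ord prednK.
have formula k : (k <= N + 2)%N ->
    d k = (\prod_(j < N) x j) / p ^+ (N + 2)
          * (sigma (N%:Z + 1 - k%:Z) y - sigma (N%:Z + 2 - k%:Z) y).
  move=> le_k; rewrite (expansion_coef _ hd) ?hp //; last by lia.
  rewrite Ppoly_comp // -hp coefZ mulrBl coefB coefXM coefXnM !coef_prod_XaddC.
  rewrite -/y size_y; congr (_ * (_ - _)).
    (* A shift below degree 0 corresponds to a [sigma] of degree above [N]. *)
    case: eqP => [-> | k_neq0]; last by congr sigma; lia.
    by rewrite sigma_gt_size // size_y; lia.
  case: ltnP => [lt_k2|le_2k]; last by congr sigma; lia.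
  by rewrite sigma_gt_size // size_y; lia.
split=> //; rewrite formula // !sigma_gt_size ?size_y; try lia.
by rewrite subrr mulr0.
Qed.
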